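(* Let $(X,\mathcal B,\mu)$ be a probability space and let $\mathfrak U=\{U_k:\ k=1,2,\ldots,n\}$ be a set of invertible commuting measure-preserving transformations of $X$ of rank $d\ge 1$. Then there is a constant $C(\mathfrak U)$, depending only on $\mathfrak U$, such that for every function $f\in L\log^{d-1}L(X)$ and every $\lambda>0$, $$\mu\left\{x\in X:\ \sup_{s_1,\ldots,s_n\ge 1}\frac{1}{s_1\cdots s_n}\sum_{k_1=0}^{s_1-1}\cdots\sum_{k_n=0}^{s_n-1}\left|f\left((U_1^{k_1}\circ\cdots\circ U_n^{k_n})(x)\right)\right|>\lambda\right\}\le C(\mathfrak U)\int_X \mathrm{Log}_{d-1}\left(\frac{|f|}{\lambda}\right)d\mu ,$$ where the supremum is over all positive integers $s_1,\ldots,s_n$.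
   Context: A measurable map $T:X\to X$ on a probability space $(X,\mathcal B,\mu)$ is measure-preserving if $T^{-1}(E)\in\mathcal B$ and $\mu(T^{-1}(E))=\mu(E)$ for every $E\in\mathcal B$. A set of invertible commuting measure-preserving transformations $\mathfrak U=\{U_k:\ k=1,\ldots,n\}$ is dependent if there are integers $p_1,\ldots,p_n$, not all zero, such that $(U_1^{p_1}\circ\cdots\circ U_n^{p_n})(x)=x$ for almost every $x\in X$; otherwise it is independent. The rank of $\mathfrak U$ is the largest integer $r$ for which there is an independent subset of cardinality $r$ in $\mathfrak U$. For an integer $m\ge1$ and $t\ge 0$ put $\mathrm{Log}_m(t)=t\left(1+\max\{0,(\log t)^m\}\right)$ (with value $0$ at $t=0$), and put $\mathrm{Log}_0(t)=t$. The class $L\log^mL(X)$ consists of the measurable functions $f$ on $X$ with $\mathrm{Log}_m(|f|)\in L^1(X)$; in particular $L\log^0L(X)=L^1(X)$. *)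

(* Defs.v *)
From HB Require Import structures.
From mathcomp Require Import all_boot all_order all_algebra.
From mathcomp Require Import all_classical all_reals all_analysis.

Set Implicit Arguments.
Unset Strict Implicit.
Unset Printing Implicit Defensive.

Import Order.TTheory GRing.Theory Num.Theory.
Import numFieldNormedType.Exports.

Local Open Scope classical_set_scope.
Local Open Scope ring_scope.

Section transformations.
Context {disp : measure_display} {X : measurableType disp} {R : realType}.
Variable mu : probability X R.

Definition measure_preserving (T : X -> X) : Prop :=
  measurable_fun [set: X] T /\
  forall E, measurable E -> mu (T @^-1` E) = mu E.

(* Invertibility is in the usual ergodic-theoretic sense: the map is bijective
   on the whole of X and its inverse is measurable (hence the inverse is
   measure-preserving as well). *)
Record invertible_mpt := InvertibleMpt {
  mpt_fun :> X -> X;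
  mpt_inv : X -> X;
  mpt_funK : cancel mpt_fun mpt_inv;
  mpt_invK : cancel mpt_inv mpt_fun;
  mpt_preserving : measure_preserving mpt_fun;
  mpt_inv_measurable : measurable_fun [set: X] mpt_inv }.

Definition mpt_zpow (T : invertible_mpt) (p : int) : X -> X :=
  match p with
  | Posz m => iter m T
  | Negz m => iter m.+1 (mpt_inv T)
  end.

Variables (n : nat) (U : 'I_n -> invertible_mpt).

Definition commuting : Prop :=
  forall (i j : 'I_n) (x : X), U i (U j x) = U j (U i x).

(* Subsets of the family are given by sets J of indices; an index set on which
   U is not injective is dependent, so repetitions in U do not affect rank. *)
Definition dependent (J : {set 'I_n}) : Prop :=
  exists p : 'I_n -> int,
    (exists2 i, i \in J & p i != 0) /\
    {ae mu, forall x,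
      (\big[(@comp X X X)/id]_(i in J) mpt_zpow (U i) (p i)) x = x}.

Definition independent (J : {set 'I_n}) : Prop := ~ dependent J.

(* The empty set is independent, so the rank is 0 exactly when every nonempty
   subfamily is dependent. *)
Definition mpt_rank : nat := (\max_(J : {set 'I_n} | `[< independent J >]) #|J|)%N.

Definition iter_family (k : 'I_n -> nat) : X -> X :=
  \big[(@comp X X X)/id]_(i < n) iter (k i) (U i).

(* The index k of the sum ranges over the box of all (k_i)_i with
   k_i < s_i for each i. *)
Definition rect_average (f : X -> R) (s : 'I_n -> nat) (x : X) : R :=
  (\prod_(i < n) (s i)%:R)^-1 *
  \sum_(k : {dffun forall i : 'I_n, 'I_(s i)})
     `|f (iter_family (fun i => k i : nat) x)|.

Definition strong_maximal (f : X -> R) (x : X) : \bar R :=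
  ereal_sup [set (rect_average f s x)%:E |
             s in [set s : 'I_n -> nat | forall i, (0 < s i)%N]].

End transformations.

Section Zygmund_class.
Context {R : realType}.

(* For 0 < m the value at t = 0 is 0 thanks to the factor t. *)
Definition Log (m : nat) (t : R) : R :=
  if m is 0%N then t else t * (1 + Num.max 0 (ln t ^+ m)).

Definition LlogL {disp : measure_display} {X : measurableType disp}
    (mu : probability X R) (m : nat) (f : X -> R) : Prop :=
  measurable_fun [set: X] f /\
  mu.-integrable [set: X] (fun x => (Log m `|f x|)%:E).

End Zygmund_class.

(* Main.v *)
(** Along one transformation, the maximal ergodic theorem gives the weak (1,1)
    inequality for two-sided averages; composing [m] such maximal operators costs one
    logarithm per additional operator (Zygmund's argument, run here on dyadic level
    sets), so averages over boxes in [m] commuting transformations satisfy a weak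
    [L log^(m-1) L] inequality.

    If a set of transformations is dependent through the relation
    [prod_j U_j^(p_j) = id], consider a box with sides [s_j] and a direction [i] with
    [p_i != 0] for which [s_i / |p_i|] is minimal.  Modulo the relation, a power
    [U_i^k] with [|k| <= s_i] is [U_i^r], [|r| <= |p_i|], times a product of
    [U_j^(b_j)], [j != i], with [|b_j| <= s_j].  The average over the box is thus
    dominated by averages over doubled boxes in the remaining directions, and the
    finitely many candidates for [i] are treated one by one.  Removing directions until
    the set is independent leaves at most rank-many of them. *)

Require Import Defs.
From HB Require Import structures.
From mathcomp Require Import all_boot all_order all_algebra.
From mathcomp Require Import all_classical all_reals all_analysis.
From mathcomp Require Import measurable_realfun.
From mathcomp Require Import zify ring lra.

Set Implicit Arguments.
Unset Strict Implicit.
Unset Printing Implicit Defensive.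

Import Order.TTheory GRing.Theory Num.Theory.
Import numFieldNormedType.Exports.

Local Open Scope classical_set_scope.
Local Open Scope ring_scope.

(** * Integrals under measure-preserving maps *)

Section measure_preserving_maps.
Context {disp : measure_display} {X : measurableType disp} {R : realType}.
Variable mu : probability X R.

Lemma ge0_integral_comp_mp (T : X -> X) (f : X -> \bar R) :
  measure_preserving mu T -> measurable_fun [set: X] f ->
  (forall x, 0 <= f x)%E -> (\int[mu]_x f (T x) = \int[mu]_x f x)%E.
Proof.
move=> [mT muT] mf f0.
have := ge0_integral_pushforward mT mu (D := setT) measurableT mf (fun y _ => f0 y).
rewrite preimage_setT => <-.
by apply: eq_measure_integral => A mA _; exact: muT.
Qed.

Lemma measurable_gtr (f : X -> R) (a : R) :
  measurable_fun [set: X] f -> measurable [set x | a < f x].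
Proof.
move=> mf; rewrite (_ : [set x | _] = [set: X] `&` f @^-1` `]a, +oo[).
  exact: mf.
by apply/seteqP; split => x /=; rewrite in_itv/= andbT; tauto.
Qed.

Lemma mu_indicE (A : set X) : measurable A ->
  (\int[mu]_x (\1_A x)%:E = mu A)%E.
Proof. by move=> mA; rewrite integral_indic// setIT. Qed.

End measure_preserving_maps.

(** * The maximal ergodic theorem for one transformation *)

Section maximal_ergodic_theorem.
Context {disp : measure_display} {X : measurableType disp} {R : realType}.
Variable mu : probability X R.
Variables (T : X -> X) (T_mp : measure_preserving mu T).
Variables (g : X -> R) (lam : R).

(** This is the maximum over [s <= N] of the sums of [g (T^k x) - lam] over [k < s], the empty sum
    included. The recursive form makes the identity used in the maximal ergodic theorem
    definitional. *)
Fixpoint max_ergodic_sum (N : nat) (x : X) : R :=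
  if N is N'.+1 then Num.max 0 (g x - lam + max_ergodic_sum N' (T x)) else 0.

Lemma max_ergodic_sum_ge0 N x : 0 <= max_ergodic_sum N x.
Proof. by case: N => //= N; rewrite le_max lexx. Qed.

Lemma max_ergodic_sum_nd N x : max_ergodic_sum N x <= max_ergodic_sum N.+1 x.
Proof.
elim: N x => [|N IH] x; first exact: max_ergodic_sum_ge0.
rewrite [leRHS]/= [leLHS]/= ge_max !le_max lexx /= lerD2l.
by rewrite IH orbT.
Qed.

Lemma ergodic_sum_le_max N s x : (s <= N)%N ->
  \sum_(0 <= k < s) (g (iter k T x) - lam) <= max_ergodic_sum N x.
Proof.
elim: N s x => [|N IH] [|s] x sN //.
- by rewrite big_geq.
- by rewrite big_geq// max_ergodic_sum_ge0.
rewrite big_nat_recl//= le_max; apply/orP; right; rewrite lerD2l.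
apply: le_trans (IH s (T x) sN).
by rewrite le_eqVlt; apply/orP; left; apply/eqP/eq_bigr => i _; rewrite -iterS iterSr.
Qed.

Hypothesis mg : measurable_fun [set: X] g.

Lemma measurable_max_ergodic_sum N : measurable_fun [set: X] (max_ergodic_sum N).
Proof.
elim: N => [|N IH] /=; first exact: measurable_cst.
apply: measurable_maxr => //; apply: measurable_funD.
  exact: measurable_funB.
by apply: (measurableT_comp IH); case: T_mp.
Qed.

Hypotheses (g0 : forall x, 0 <= g x) (lam0 : 0 <= lam).

(** By induction, since [F N.+1 <= g + F N \o T] and [T] preserves integrals. Finiteness lets the
    integral of [F N] be cancelled in [maximal_ergodic]. *)
Lemma max_ergodic_sum_integral_fin N : (\int[mu]_x (g x)%:E < +oo)%E ->
  (\int[mu]_x (max_ergodic_sum N x)%:E < +oo)%E.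
Proof.
move=> gfin; elim: N => [|N IH]; first by rewrite integral0 ltry.
have mS := measurable_max_ergodic_sum N.
have mgE : measurable_fun [set: X] (EFin \o g) by apply/measurable_EFinP.
have mSE : measurable_fun [set: X] (EFin \o max_ergodic_sum N) by apply/measurable_EFinP.
have mST : measurable_fun [set: X] (fun x => (max_ergodic_sum N (T x))%:E).
  by apply: (measurableT_comp mSE); case: T_mp.
apply: (@le_lt_trans _ _ (\int[mu]_x ((g x)%:E + (max_ergodic_sum N (T x))%:E))%E).
  apply: ge0_le_integral => //.
  - by move=> x _; rewrite lee_fin max_ergodic_sum_ge0.
  - by apply/measurable_EFinP; exact: measurable_max_ergodic_sum.
  - exact: emeasurable_funD.
  - move=> x _; rewrite -EFinD lee_fin [leLHS]/= ge_max.
    rewrite addr_ge0// ?max_ergodic_sum_ge0//= lerD2r lerBlDr lerDl.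
    exact: lam0.
rewrite ge0_integralD//; last 2 first.
  - by move=> x _; rewrite lee_fin.
  - by move=> x _; rewrite lee_fin max_ergodic_sum_ge0.
apply: lte_add_pinfty => //; rewrite (ge0_integral_comp_mp T_mp mSE)// => x.
by rewrite /= lee_fin max_ergodic_sum_ge0.
Qed.

(* On the set where the maximal sum [F N] is positive,
   [F N <= F N.+1 = g - lam + F N \o T]; elsewhere [F N = 0 <= F N \o T]. *)
Lemma maximal_ergodic N :
  (lam%:E * mu [set x | 0 < max_ergodic_sum N x]%R <= \int[mu]_x (g x)%:E)%E.
Proof.
set E := [set x | _].
have [gfin|] := ltP (\int[mu]_x (g x)%:E)%E +oo%E; last first.
  by rewrite leye_eq => /eqP ->; rewrite leey.
have mS := measurable_max_ergodic_sum N.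
have mE : measurable E by exact: measurable_gtr.
have mgE : measurable_fun [set: X] (EFin \o g) by apply/measurable_EFinP.
have mSE : measurable_fun [set: X] (EFin \o max_ergodic_sum N) by apply/measurable_EFinP.
have mST : measurable_fun [set: X] (fun x => (max_ergodic_sum N (T x))%:E).
  by apply: (measurableT_comp mSE); case: T_mp.
have mIE : measurable_fun [set: X] (fun x => (\1_E x : R)%:E).
  by apply/measurable_EFinP; exact: measurable_indic.
have S0 x : (0 <= (max_ergodic_sum N x)%:E)%E by rewrite lee_fin max_ergodic_sum_ge0.
have : (\int[mu]_x ((max_ergodic_sum N x)%:E + lam%:E * (\1_E x)%:E) <=
        \int[mu]_x ((max_ergodic_sum N (T x))%:E + (g x)%:E))%E.
  apply: ge0_le_integral => //.
  - by move=> x _; rewrite adde_ge0// mule_ge0// lee_fin.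
  - by apply: emeasurable_funD => //; exact: measurable_funeM.
  - exact: emeasurable_funD.
  - move=> x _; rewrite -EFinM -!EFinD lee_fin indicE.
    have [|nE] := boolP (x \in E).
      rewrite inE /= => Ex; have := max_ergodic_sum_nd N x => /=.
      rewrite le_max leNgt Ex/=; lra.
    have := max_ergodic_sum_ge0 N x; rewrite le_eqVlt => /orP[/eqP <-|].
      by rewrite mulr0 addr0 addr_ge0// max_ergodic_sum_ge0.
    by move=> Ex; rewrite notin_setE in nE.
rewrite ge0_integralD//; last 2 first.
  - by move=> x _; rewrite mule_ge0// lee_fin.
  - exact: measurable_funeM.
rewrite ge0_integralD//; last by move=> x _; rewrite lee_fin.
rewrite ge0_integralZl_EFin//.
rewrite mu_indicE// (ge0_integral_comp_mp T_mp mSE)//.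
have Sfin : (\int[mu]_x (max_ergodic_sum N x)%:E)%E \is a fin_num.
  rewrite ge0_fin_numE; last exact: integral_ge0.
  exact: max_ergodic_sum_integral_fin.
by rewrite leeD2lE.
Qed.

End maximal_ergodic_theorem.

(** * Integer powers of an invertible transformation *)

Section integer_powers.
Context {disp : measure_display} {X : measurableType disp} {R : realType}.
Context {mu : probability X R}.
Implicit Types T : invertible_mpt mu.

Lemma mpt_zpowS T p x : mpt_zpow T (p + 1) x = T (mpt_zpow T p x).
Proof.
case: p => m; first by rewrite -PoszD addn1.
case: m => [|m]; first by rewrite /= mpt_invK.
by rewrite (_ : Negz m.+1 + 1 = Negz m) /= ?mpt_invK// !NegzE; lia.
Qed.

Lemma mpt_zpowB1 T p x : mpt_zpow T (p - 1) x = mpt_inv T (mpt_zpow T p x).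
Proof. by rewrite -[in RHS](subrK 1 p) mpt_zpowS mpt_funK. Qed.

Lemma mpt_zpowD T p q x : mpt_zpow T (p + q) x = mpt_zpow T p (mpt_zpow T q x).
Proof.
elim: p => [|m IH|m IH]; first by rewrite add0r.
- by rewrite -addn1 PoszD addrAC mpt_zpowS IH -mpt_zpowS.
- by rewrite -addn1 PoszD opprD addrAC mpt_zpowB1 IH -mpt_zpowB1.
Qed.

Lemma measure_preserving_comp (S T : X -> X) :
  measure_preserving mu S -> measure_preserving mu T ->
  measure_preserving mu (S \o T).
Proof.
move=> [mS muS] [mT muT]; split; first exact: measurableT_comp.
move=> A mA; rewrite comp_preimage muT ?muS//.
by rewrite -[X in measurable X]setTI; exact: mS.
Qed.

Lemma measure_preserving_inv T : measure_preserving mu (mpt_inv T).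
Proof.
have mT := mpt_inv_measurable T; split=> // A mA.
have mA' : measurable (mpt_inv T @^-1` A) by rewrite -[X in measurable X]setTI; exact: mT.
have [_ <-//] := mpt_preserving T.
by congr (mu _); apply/seteqP; split => x /=; rewrite mpt_funK.
Qed.

Lemma measure_preserving_id : measure_preserving mu id.
Proof. by split. Qed.

Lemma measure_preserving_zpow T p : measure_preserving mu (mpt_zpow T p).
Proof.
have iter_mp (S : X -> X) m : measure_preserving mu S -> measure_preserving mu (iter m S).
  move=> S_mp; elim: m => [|m IH]; first exact: measure_preserving_id.
  exact: measure_preserving_comp.
case: p => m; apply: iter_mp; first exact: mpt_preserving.
exact: measure_preserving_inv.
Qed.

End integer_powers.

(** * Two-sided averages and their weak (1,1) inequality *)

Section symmetric_averages.
Context {disp : measure_display} {X : measurableType disp} {R : realType}.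
Context {mu : probability X R}.
Implicit Types (T : invertible_mpt mu) (f g : X -> R).

(* The [2 * s + 1] terms are normalized by [4 * (s + 1)], so that a symmetric
   average is at most 1/4 times the sum of a forward and a backward average:
   [weak_type_sym_max] then has the same level on both sides and iterates without
   rescaling. *)
Definition sym_avg T (s : nat) f (x : X) : R :=
  (4 * s.+1%:R)^-1 * \sum_(0 <= k < (s + s).+1) f (mpt_zpow T (k%:Z - s%:Z) x).

Definition sym_max T (N : nat) f (x : X) : R :=
  \big[Num.max/0]_(s < N.+1) sym_avg T s f x.

Lemma measurable_zpow_comp T p f : measurable_fun [set: X] f ->
  measurable_fun [set: X] (fun x => f (mpt_zpow T p x)).
Proof.
by move=> mf; apply: measurableT_comp => //; have [] := measure_preserving_zpow T p.
Qed.

Lemma measurable_sym_avg T s f : measurable_fun [set: X] f ->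
  measurable_fun [set: X] (sym_avg T s f).
Proof.
move=> mf; apply: measurable_funM; first exact: measurable_cst.
by apply: measurable_sum => k; exact: measurable_zpow_comp.
Qed.

Lemma measurable_sym_max T N f : measurable_fun [set: X] f ->
  measurable_fun [set: X] (sym_max T N f).
Proof.
move=> mf; rewrite /sym_max; elim: (index_enum _) => [|s r IH].
  by under eq_fun do rewrite big_nil; exact: measurable_cst.
under eq_fun do rewrite big_cons.
by apply: measurable_maxr => //; exact: measurable_sym_avg.
Qed.

Lemma sym_avg_ge0 T s f : (forall x, 0 <= f x) -> forall x, 0 <= sym_avg T s f x.
Proof. by move=> f0 x; rewrite mulr_ge0// sumr_ge0. Qed.

Lemma sym_max_ge0 T N f x : 0 <= sym_max T N f x.
Proof. exact: bigmax_ge_id. Qed.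

Lemma sym_avg_le_max T N s f x : (s <= N)%N -> sym_avg T s f x <= sym_max T N f x.
Proof.
move=> sN; rewrite -ltnS in sN.
exact: (le_bigmax_cond _ (j := Ordinal sN) (fun s : 'I_N.+1 => sym_avg T s f x)).
Qed.

Lemma le_sym_avg T s f g : (forall x, f x <= g x) ->
  forall x, sym_avg T s f x <= sym_avg T s g x.
Proof. by move=> fg x; rewrite ler_wpM2l ?invr_ge0 ?mulr_ge0// ler_sum. Qed.

Lemma le_sym_max T N M f g : (N <= M)%N -> (forall x, f x <= g x) ->
  forall x, sym_max T N f x <= sym_max T M g x.
Proof.
move=> NM fg x; apply: (@le_trans _ _ (sym_max T N g x)).
  by apply: le_bigmax2 => s _; exact: le_sym_avg.
exact: (@le_bigmax_ord _ _ _ N.+1 M.+1 xpredT (fun s => sym_avg T s g x)).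
Qed.

Lemma mpt_zpow_opp T k x : mpt_zpow T (- k%:Z) x = iter k (mpt_inv T) x.
Proof. by case: k => //= k; rewrite -NegzE. Qed.

(** Split the window at its centre: exponents [0..s] give the forward sum, negative ones the
    backward sum without its zeroth term, which is added back because [f] is nonnegative. *)
Lemma sym_avg_le_two_sided T s f x : (forall x, 0 <= f x) ->
  4 * sym_avg T s f x <= s.+1%:R^-1 * \sum_(0 <= k < s.+1) f (iter k T x) +
                     s.+1%:R^-1 * \sum_(0 <= k < s.+1) f (iter k (mpt_inv T) x).
Proof.
move=> f0; rewrite /sym_avg invfM mulrA mulVKf// -mulrDr ler_wpM2l// addrC.
rewrite (@big_cat_nat _ _ _ s) //=; last by rewrite -addnS leq_addr.
apply: lerD.
  rewrite big_nat_rev/= add0n [leRHS]big_nat_recl//= ler_wpDl//.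
  rewrite le_eqVlt; apply/orP; left; apply/eqP; apply: eq_big_nat => k /andP[_ ks].
  rewrite (_ : _ - _ = - (k.+1)%:Z) ?mpt_zpow_opp//; lia.
rewrite -{1}[s]add0n big_addn -addSn addnK.
rewrite le_eqVlt; apply/orP; left; apply/eqP; apply: eq_big_nat => k _.
by rewrite (_ : _ - _ = k%:Z)//; lia.
Qed.

(** Keeping only the part of [f] above the level in the weak-type bound is what allows summation
    over dyadic levels later on. *)
Definition cut (lam : R) f (x : X) : R := f x * \1_[set y | lam < f y] x.

Lemma measurable_cut lam f : measurable_fun [set: X] f ->
  measurable_fun [set: X] (cut lam f).
Proof.
move=> mf; apply: measurable_funM => //; apply: measurable_indic.
exact: measurable_gtr.
Qed.

Lemma cut_ge0 lam f : (forall x, 0 <= f x) -> forall x, 0 <= cut lam f x.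
Proof. by move=> f0 x; rewrite mulr_ge0. Qed.

Lemma le_cut lam f x : 0 <= lam -> f x <= cut lam f x + lam.
Proof.
move=> lam0; rewrite /cut indicE; have [_|] := boolP (x \in _).
  by rewrite mulr1 lerDl.
by rewrite notin_setE /= => /negP; rewrite -leNgt mulr0 add0r.
Qed.

(** Since [g <= cut lam g + lam], an average of [g] above [2 * lam] forces the corresponding sum of
    [cut lam g - lam] to be positive. The maximal ergodic theorem for [cut lam g] bounds the set
    where this happens. *)
Lemma weak_type_one_sided (S : X -> X) g lam N : measure_preserving mu S ->
  measurable_fun [set: X] g -> (forall x, 0 <= g x) -> 0 < lam ->
  exists E, [/\ measurable E,
    (lam%:E * mu E <= \int[mu]_x (cut lam g x)%:E)%E &
    forall x s, (s <= N)%N ->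
      lam * 2 < s.+1%:R^-1 * \sum_(0 <= k < s.+1) g (iter k S x) -> E x].
Proof.
move=> S_mp mg g0 lam0.
have mc := measurable_cut lam mg.
have c0 := cut_ge0 lam g0.
(* The index is [N.+1] because an average with parameter [s <= N] has [s.+1] terms. *)
exists [set x | 0 < max_ergodic_sum S (cut lam g) lam N.+1 x]; split.
- by apply: measurable_gtr; apply: measurable_max_ergodic_sum mc _ => //; exact: S_mp.
- by apply: maximal_ergodic => //; exact: ltW.
move=> x s sN /=; rewrite ltr_pdivlMl ?ltr0n// => H.
apply: lt_le_trans (ergodic_sum_le_max S (cut lam g) lam x (s := s.+1) (N := N.+1) sN).
apply: (@lt_le_trans _ _ (\sum_(0 <= k < s.+1) (g (iter k S x) - lam * 2))).
  by rewrite sumrB big_const_nat iter_addr addr0 subn0 subr_gt0 -[ltLHS]mulr_natl.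
apply: ler_sum => k _; have := le_cut g (iter k S x) (ltW lam0); lra.
Qed.

(** If a symmetric average exceeds [lam], its quadruple exceeds [4 * lam], so the forward or the
    backward average exceeds [2 * lam]. The two exceptional sets account for the factor 2. *)
Lemma weak_type_sym_max T N g lam :
  measurable_fun [set: X] g -> (forall x, 0 <= g x) -> 0 < lam ->
  (mu [set x | lam < sym_max T N g x]%R <=
   (2 / lam)%:E * \int[mu]_x (cut lam g x)%:E)%E.
Proof.
move=> mg g0 lam0.
have [E [mE muE HE]] := weak_type_one_sided N (mpt_preserving T) mg g0 lam0.
have [F [mF muF HF]] := weak_type_one_sided N (measure_preserving_inv T) mg g0 lam0.
have msub : measurable [set x | lam < sym_max T N g x].
  by apply: measurable_gtr; exact: measurable_sym_max.
apply: (@le_trans _ _ (mu (E `|` F))).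
  apply: le_measure; rewrite ?inE//; first exact: measurableU.
  move=> x /= Hx.
  have [s Hs] : exists s : 'I_N.+1, lam < sym_avg T s g x.
    apply: contrapT => /forallNP no; move: Hx; apply/negP; rewrite -leNgt.
    apply: bigmax_le => [|s _]; first exact: ltW.
    by rewrite leNgt; apply/negP; exact: no.
  have sN : (s <= N)%N by rewrite -ltnS.
  have := sym_avg_le_two_sided T s x g0.
  set a := _^-1 * _; set b := _^-1 * _ => Hab.
  have [Ha|Ha] := ltP (lam * 2) a; first by left; exact: HE sN Ha.
  right; apply: HF sN _; rewrite -/b; lra.
apply: le_trans (measureU2 mu mE mF) _.
have -> : ((2 / lam)%:E * \int[mu]_x (cut lam g x)%:E =
   lam^-1%:E * \int[mu]_x (cut lam g x)%:E + lam^-1%:E * \int[mu]_x (cut lam g x)%:E)%E.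
  rewrite -ge0_muleDl ?lee_fin ?invr_ge0 ?ltW// -EFinD.
  by congr (_%:E * _)%E; ring.
by apply: leeD; rewrite lee_pdivlMl.
Qed.
End symmetric_averages.

(** * Dyadic sums as substitutes for the functions [t log^m t] *)

Section dyadic_sums.
Context {R : realType}.
Implicit Types (a : nat -> R) (t : R).

(** Only finitely many terms are nonzero. The series form is meant for integration term by term,
    which turns the indicators into measures of superlevel sets. *)
Definition dyadic_sum a t : \bar R := (\sum_(i <oo) (a i * (2 ^+ i < t)%R%:R)%:E)%E.

Lemma dyadic_level t : 1 < t ->
  exists N, t <= 2 ^+ N.+1 /\ forall i, (2 ^+ i < t) = (i <= N)%N.
Proof.
move=> t1.
have exN : exists N, t <= 2 ^+ N.
  exists (Num.truncn t).+1; apply/ltW/(lt_trans (truncnS_gt t)).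
  by rewrite -natrX ltr_nat ltn_expl.
case: (ex_minnP exN) => -[|N] tN Nmin; first by rewrite expr0 leNgt t1 in tN.
exists N; split=> // i; rewrite ltNge.
have [iN|Ni] := leqP i N.
  by apply: contraT; rewrite negbK => /Nmin; rewrite ltnNge iN.
by rewrite (le_trans tN)// ler_weXn2l ?ler1n.
Qed.

Lemma dyadic_sum_eq0 a t : t <= 1 -> dyadic_sum a t = 0%E.
Proof.
move=> t1; apply: eseries0 => i _ _; rewrite ltNge (le_trans t1) ?mulr0//.
by rewrite exprn_ege1 ?ler1n.
Qed.

Lemma dyadic_sumE a t N : (forall i, 0 <= a i) -> (forall i, (2 ^+ i < t) = (i <= N)%N) ->
  dyadic_sum a t = (\sum_(0 <= i < N.+1) a i)%:E.
Proof.
move=> a0 tN; rewrite /dyadic_sum (nneseries_split 0 N.+1); last first.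
  by move=> k _; rewrite lee_fin mulr_ge0.
rewrite eseries0 ?adde0; last first.
  by move=> i /= Ni _; rewrite tN leqNgt Ni mulr0.
rewrite add0n sumEFin; congr _%:E; apply: eq_big_nat => i /andP[_ iN].
by rewrite tN -ltnS iN mulr1.
Qed.

Lemma dyadic_sum_ge0 a t : (forall i, 0 <= a i) -> (0 <= dyadic_sum a t)%E.
Proof. by move=> a0; apply: nneseries_ge0 => i _ _; rewrite lee_fin mulr_ge0. Qed.

Lemma le_dyadic_sum a b t u : (forall i, 0 <= a i) -> (forall i, a i <= b i) -> t <= u ->
  (dyadic_sum a t <= dyadic_sum b u)%E.
Proof.
move=> a0 ab tu; apply: lee_nneseries => [i _ _|i _]; rewrite lee_fin ?mulr_ge0//.
apply: ler_pM => //; rewrite ler_nat.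
by have [ti|//] := ltP (2 ^+ i) t; rewrite (lt_le_trans ti tu).
Qed.

(* With these weights [dyadic_sum] is comparable to [t |-> t * (1 + log+ t) ^ m.-1]
   for [t > 1]; at [m = 0] it is the indicator function of [t > 1]. *)
Definition zyg_weight (m i : nat) : R :=
  if m is k.+1 then 2 ^+ i * i.+1%:R ^+ k else (i == 0%N)%:R.

Definition zyg m t := dyadic_sum (zyg_weight m) t.

Lemma zyg_weight_ge0 m i : 0 <= zyg_weight m i.
Proof. by case: m => [|m] /=; rewrite ?ler0n// mulr_ge0// exprn_ge0. Qed.

Lemma zyg_ge0 m t : (0 <= zyg m t)%E.
Proof. exact/dyadic_sum_ge0/zyg_weight_ge0. Qed.

Lemma le_zyg_weight m k i : (m <= k)%N -> zyg_weight m i <= zyg_weight k i.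
Proof.
case: m => [|m]; case: k => [|k] //= mk.
  by case: i => [|i]; rewrite ?expr0 ?expr1n ?mulr1//= mulr_ge0// exprn_ge0.
by rewrite ler_wpM2l ?exprn_ge0// ler_weXn2l ?ler1n.
Qed.

Lemma le_zyg m k t u : (m <= k)%N -> t <= u -> (zyg m t <= zyg k u)%E.
Proof.
move=> mk; apply: le_dyadic_sum => [i|i]; first exact: zyg_weight_ge0.
exact: le_zyg_weight.
Qed.

Lemma zyg0_gt1 t : 1 < t -> (1 <= zyg 0 t)%E.
Proof.
move=> t1; have [N [_ tN]] := dyadic_level t1.
rewrite /zyg (dyadic_sumE _ tN); last by move=> i; exact: zyg_weight_ge0.
by rewrite big_nat_recl//= lee_fin lerDl sumr_ge0.
Qed.

(** For positive [m], division by [2 ^+ i] leaves [N.+1] terms, each at most [N.+1 ^ (m - 1)]. The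
    power gained by summing is the logarithm that each maximal operator costs. *)
Lemma sum_zyg_weight_div m N :
  \sum_(0 <= i < N.+1) zyg_weight m i / 2 ^+ i <= N.+1%:R ^+ m.
Proof.
case: m => [|m] /=.
  by rewrite big_nat_recl//= big1 ?addr0 ?expr0 ?divr1// => i _; rewrite mul0r.
rewrite big_nat (@le_trans _ _ (\sum_(0 <= i < N.+1) N.+1%:R ^+ m))//.
  rewrite -big_nat ler_sum_nat// => i /andP[_ iN].
  rewrite mulrAC mulfV ?expf_neq0// mul1r.
  by rewrite lerXn2r ?nnegrE ?ler0n// ler_nat.
by rewrite big_const_nat subn0 iter_addr addr0 exprSr mulr_natr.
Qed.

Lemma dyadic_sum_le_zygS m t :
  (dyadic_sum (fun i => zyg_weight m i / 2 ^+ i * t)%R t <= 2%:E * zyg m.+1 t)%E.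
Proof.
have [t1|t1] := leP t 1; first by rewrite dyadic_sum_eq0// mule_ge0// zyg_ge0.
have [N [tle tN]] := dyadic_level t1.
have t0 : 0 <= t by apply: ltW; rewrite (lt_trans ltr01).
rewrite /zyg !(dyadic_sumE _ tN); last 2 first.
- by move=> i; exact: zyg_weight_ge0.
- by move=> i; rewrite mulr_ge0// divr_ge0 ?zyg_weight_ge0// exprn_ge0.
(* The last term [2 ^+ N * N.+1 ^+ m] of [zyg m.+1 t] suffices, because [t <= 2 ^+ N.+1]. *)
rewrite -EFinM lee_fin -mulr_suml [X in _ <= 2 * X]big_nat_recr//=.
apply: (@le_trans _ _ (N.+1%:R ^+ m * 2 ^+ N.+1)).
  apply: ler_pM => //; last exact: sum_zyg_weight_div.
  by rewrite sumr_ge0// => i _; rewrite divr_ge0 ?zyg_weight_ge0// exprn_ge0.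
rewrite exprS mulrCA ler_wpM2l// mulrC lerDr sumr_ge0//.
Qed.

End dyadic_sums.

(** * Integrals of dyadic sums and the cost of one maximal operator *)

Section dyadic_integrals.
Context {disp : measure_display} {X : measurableType disp} {R : realType}.
Context {mu : probability X R}.

Lemma measurable_dyadic_term (a : X -> R) (h : X -> R) i :
  measurable_fun [set: X] a -> measurable_fun [set: X] h ->
  measurable_fun [set: X] (fun x => (a x * (2 ^+ i < h x)%R%:R)%:E).
Proof.
move=> ma mh; apply/measurable_EFinP/measurable_funM => //.
rewrite (_ : (fun x => _) = \1_[set x | 2 ^+ i < h x]).
  exact/measurable_indic/measurable_gtr.
by apply/funext => x; rewrite indicE mem_setE.
Qed.

Lemma measurable_dyadic_sum (a : nat -> X -> R) (h : X -> R) :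
  (forall i x, 0 <= a i x) -> (forall i, measurable_fun [set: X] (a i)) ->
  measurable_fun [set: X] h ->
  measurable_fun [set: X] (fun x => dyadic_sum (a^~ x) (h x)).
Proof.
move=> a0 ma mh; apply: (ge0_emeasurable_sum (P := xpredT)) => [i x _ _|i _].
  by rewrite lee_fin mulr_ge0.
exact: measurable_dyadic_term.
Qed.

Lemma measurable_zyg m (h : X -> R) : measurable_fun [set: X] h ->
  measurable_fun [set: X] (fun x => zyg m (h x)).
Proof.
move=> mh; apply: (measurable_dyadic_sum (a := fun i _ => zyg_weight m i)) => // i x.
exact: zyg_weight_ge0.
Qed.

Lemma integral_dyadic_sum (a : nat -> X -> R) (h : X -> R) :
  (forall i x, 0 <= a i x) -> (forall i, measurable_fun [set: X] (a i)) ->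
  measurable_fun [set: X] h ->
  (\int[mu]_x dyadic_sum (a^~ x) (h x) =
   \sum_(i <oo) \int[mu]_x (a i x * (2 ^+ i < h x)%R%:R)%:E)%E.
Proof.
move=> a0 ma mh; rewrite integral_nneseries// => i.
  exact: measurable_dyadic_term.
by move=> x _; rewrite lee_fin mulr_ge0.
Qed.

(** The left side is the sum of [zyg_weight m i] times the measure of the superlevel set at
    [2 ^+ i]. The weak inequality at each level bounds it by the integral of [g] times the sum of
    [2 * zyg_weight m i / 2 ^+ i] over the levels below [g], and [dyadic_sum_le_zygS] gives the
    other factor 2. *)
Lemma integral_zyg_sym_max (T : invertible_mpt mu) N m (g : X -> R) :
  measurable_fun [set: X] g -> (forall x, 0 <= g x) ->
  (\int[mu]_x zyg m (sym_max T N g x) <= 4%:E * \int[mu]_x zyg m.+1 (g x))%E.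
Proof.
move=> mg g0.
have w0 i : 0 <= zyg_weight m i :> R by exact: zyg_weight_ge0.
have p0 i : 0 <= 2 ^+ i :> R by rewrite exprn_ge0.
have mQ := measurable_sym_max T N mg.
pose b i x : R := 2 * (zyg_weight m i / 2 ^+ i * g x).
have b0 i x : 0 <= b i x by rewrite mulr_ge0// mulr_ge0// divr_ge0.
have mb i : measurable_fun [set: X] (b i).
  by apply: measurable_funM => //; apply: measurable_funM.
apply: (@le_trans _ _ (\int[mu]_x dyadic_sum (b^~ x) (g x))%E).
  rewrite (integral_dyadic_sum (a := fun i _ => zyg_weight m i))//.
  rewrite integral_dyadic_sum//.
  apply: lee_nneseries => [i _ _|i _].
    by apply: integral_ge0 => x _; rewrite lee_fin mulr_ge0.
  rewrite (eq_integral (fun x => ((zyg_weight m i)%:E *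
      (\1_[set y | 2 ^+ i < sym_max T N g y] x)%:E)%E)); last first.
    by move=> x _; rewrite -EFinM indicE mem_setE.
  rewrite ge0_integralZl_EFin//; last first.
    by apply/measurable_EFinP/measurable_indic; exact: measurable_gtr.
  rewrite mu_indicE; last exact: measurable_gtr.
  have p1 : 0 < 2 ^+ i :> R by rewrite exprn_gt0.
  apply: le_trans (lee_wpmul2l _ (weak_type_sym_max T N mg g0 p1)) _.
    by rewrite lee_fin.
  rewrite muleA -EFinM -ge0_integralZl_EFin//; last 3 first.
  - by move=> x _; rewrite lee_fin cut_ge0.
  - by apply/measurable_EFinP; exact: measurable_cut.
  - by rewrite mulr_ge0// divr_ge0.
  rewrite le_eqVlt; apply/orP; left; apply/eqP/eq_integral => x _.
  rewrite -EFinM; congr _%:E.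
  by rewrite /b /cut indicE mem_setE; ring.
rewrite -ge0_integralZl_EFin//; last 2 first.
- by move=> x _; exact: zyg_ge0.
- exact: measurable_zyg.
apply: ge0_le_integral => //.
- by move=> x _; exact: dyadic_sum_ge0.
- exact: measurable_dyadic_sum.
- by apply: measurable_funeM; exact: measurable_zyg.
move=> x _.
have -> : dyadic_sum (b^~ x) (g x) =
    (2%:E * dyadic_sum (fun i => zyg_weight m i / 2 ^+ i * g x)%R (g x))%E.
  rewrite -nneseriesZl; last by move=> i _; rewrite lee_fin mulr_ge0// mulr_ge0// divr_ge0.
  by apply: eq_eseriesr => i _; rewrite -EFinM mulrA.
apply: le_trans (lee_wpmul2l _ (dyadic_sum_le_zygS m (g x))) _ => //.
by rewrite muleA -EFinM -natrM.
Qed.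

End dyadic_integrals.

(** * Iterated averages over boxes and Zygmund's inequality *)

Section iterated_averages.
Context {disp : measure_display} {X : measurableType disp} {R : realType}.
Context {mu : probability X R} {n : nat}.
Variable U : 'I_n -> invertible_mpt mu.
Implicit Types (l : seq 'I_n) (s : 'I_n -> nat) (f g : X -> R).

(** The head of the list acts first, so inductions on the list replace [f] by its average and keep
    the evaluation point. The entries of [s] are half-widths. *)
Fixpoint box_avg l s f : X -> R :=
  if l is i :: l' then box_avg l' s (sym_avg (U i) (s i) f) else f.

Fixpoint box_max l (N : nat) f : X -> R :=
  if l is i :: l' then box_max l' N (sym_max (U i) N f) else f.

Lemma measurable_box_avg l s f : measurable_fun [set: X] f ->
  measurable_fun [set: X] (box_avg l s f).
Proof. by elim: l f => //= i l IH f mf; exact/IH/measurable_sym_avg. Qed.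

Lemma measurable_box_max l N f : measurable_fun [set: X] f ->
  measurable_fun [set: X] (box_max l N f).
Proof. by elim: l f => //= i l IH f mf; exact/IH/measurable_sym_max. Qed.

Lemma le_box_max l N M f g : (N <= M)%N -> (forall x, f x <= g x) ->
  forall x, box_max l N f x <= box_max l M g x.
Proof.
by move=> NM; elim: l f g => //= i l IH f g fg; apply: IH; exact: le_sym_max.
Qed.

Lemma le_box_avg l s f g : (forall x, f x <= g x) ->
  forall x, box_avg l s f x <= box_avg l s g x.
Proof. by elim: l f g => //= i l IH f g fg; apply: IH; exact: le_sym_avg. Qed.

Lemma box_avg_ge0 l s f : (forall x, 0 <= f x) -> forall x, 0 <= box_avg l s f x.
Proof. by elim: l f => //= i l IH f f0; apply: IH; exact: sym_avg_ge0. Qed.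

Lemma box_avg_le_max l s N f : (forall i, (s i <= N)%N) ->
  forall x, box_avg l s f x <= box_max l N f x.
Proof.
move=> sN; elim: l f => //= i l IH f x.
by apply: le_trans (IH _ x) _; apply: le_box_max => // y; exact: sym_avg_le_max.
Qed.

Lemma eq_box_avg l s s' f : s =1 s' -> box_avg l s f = box_avg l s' f.
Proof. by move=> ss; elim: l f => //= i l IH f; rewrite IH ss. Qed.

(** The induction hypothesis is applied to the maximal function in the head direction, and
    [integral_zyg_sym_max] then raises the order of [zyg] by one for a factor 4. For the empty list,
    [zyg 0] dominates the indicator of values above 1. *)
Lemma weak_type_box_max l N f : measurable_fun [set: X] f -> (forall x, 0 <= f x) ->
  (mu [set x | 1 < box_max l N f x]%R <=
   (4 ^+ size l)%:E * \int[mu]_x zyg (size l) (f x))%E.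
Proof.
elim: l f => [|i l IH] f mf f0 /=.
  have mf1 : measurable [set x | 1 < f x] by exact: measurable_gtr.
  rewrite expr0 mul1e -mu_indicE//; apply: ge0_le_integral => //.
  - by apply/measurable_EFinP/measurable_indic.
  - exact: measurable_zyg.
  move=> x _; rewrite indicE; have [/set_mem f1|_] := boolP (x \in _).
    exact: (zyg0_gt1 f1).
  exact: zyg_ge0.
apply: le_trans (IH _ (measurable_sym_max _ _ mf) (sym_max_ge0 _ _ _)) _.
rewrite exprSr EFinM -muleA lee_pmul2l ?lte_fin ?exprn_gt0//.
exact: integral_zyg_sym_max.
Qed.

Definition exceed l f := [set x | exists s, 1 < box_avg l s f x].

(** Recoding [s] as a finite function makes the union countable. *)
Lemma measurable_exceed l f : measurable_fun [set: X] f -> measurable (exceed l f).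
Proof.
move=> mf; rewrite (_ : exceed l f =
    \bigcup_(s : {ffun 'I_n -> nat}) [set x | 1 < box_avg l s f x]); last first.
  apply/seteqP; split => [x [s Hs]|x [s _ Hs]]; last by exists s.
  by exists (finfun s) => //=; rewrite (eq_box_avg l f (ffunE s)).
apply: countable_bigcupT_measurable => // s.
exact/measurable_gtr/measurable_box_avg.
Qed.

(** The bound of [weak_type_box_max] is uniform in [N], and its sets increase to one containing
    [exceed l f]; continuity from below finishes. *)
Lemma zygmund_exceed l f : measurable_fun [set: X] f -> (forall x, 0 <= f x) ->
  (mu (exceed l f) <= (4 ^+ size l)%:E * \int[mu]_x zyg (size l) (f x))%E.
Proof.
move=> mf f0.
pose F N := [set x | 1 < box_max l N f x].
have mF N : measurable (F N) by exact/measurable_gtr/measurable_box_max.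
have mUF : measurable (\bigcup_N F N) by exact: bigcup_measurable.
apply: (@le_trans _ _ (mu (\bigcup_N F N))).
  apply: le_measure; rewrite ?inE//; first exact: measurable_exceed.
  move=> x [s Hs]; exists (\max_(i < n) s i)%N => //=.
  by apply: lt_le_trans Hs _; apply: box_avg_le_max => i; exact: leq_bigmax.
have ndF : {homo F : N M / (N <= M)%N >-> (N <= M)%O}.
  move=> N M NM; apply/subsetPset => x /= /lt_le_trans; apply.
  exact: le_box_max.
have cF := nondecreasing_cvg_mu (mu := mu) mF mUF ndF.
rewrite -(cvg_lim _ cF)//; apply: lime_le; first by apply/cvg_ex; eexists; exact: cF.
by apply: nearW => N; exact: weak_type_box_max.
Qed.

End iterated_averages.

(** * Truncated division; averages and commuting powers *)

Lemma int_trunc_div (k q : int) : q != 0 ->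
  exists m : int, (absz (k - m * q)%R <= absz q)%N /\ (absz m * absz q <= absz k)%N.
Proof.
move=> q0.
have e := divn_eq (absz k) (absz q).
have r : (absz k %% absz q < absz q)%N by rewrite ltn_mod absz_gt0.
set d := (absz k %/ absz q)%N in e.
(* The quotient is rounded towards zero: rounding down could make [m * q] larger than [k] in
   absolute value. *)
exists ((if (0 <= k) == (0 <= q) then 1 else -1) * d%:Z).
split; last by rewrite abszM; case: ifP => _; rewrite !mul1n e leq_addr.
by case: (leP 0 k) => k0; case: (leP 0 q) => q1 /=; nia.
Qed.

Section commuting_powers.
Context {disp : measure_display} {X : measurableType disp} {R : realType}.
Context {mu : probability X R}.
Implicit Types T : invertible_mpt mu.

Lemma zpow_commute T (h : X -> X) p : (forall x, h (T x) = T (h x)) ->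
  forall x, h (mpt_zpow T p x) = mpt_zpow T p (h x).
Proof.
move=> hT x; have hTi y : h (mpt_inv T y) = mpt_inv T (h y).
  by rewrite -[RHS](congr1 (mpt_inv T) (congr1 h (mpt_invK T y))) hT mpt_funK.
elim: p => [//|m IH|m IH].
- by rewrite -addn1 PoszD !mpt_zpowS hT IH.
- by rewrite -addn1 PoszD opprD !mpt_zpowB1 hTi IH.
Qed.

Lemma sym_avg_comp T s (f : X -> R) (h : X -> X) : (forall x, h (T x) = T (h x)) ->
  forall x, sym_avg T s (fun y => f (h y)) x = sym_avg T s f (h x).
Proof.
move=> hT x; congr (_ * _); apply: eq_bigr => k _.
by rewrite zpow_commute.
Qed.

Lemma sym_avg_sum (I : Type) (r : seq I) T s (f : I -> X -> R) x :
  sym_avg T s (fun y => \sum_(k <- r) f k y) x = \sum_(k <- r) sym_avg T s (f k) x.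
Proof. by rewrite /sym_avg exchange_big mulr_sumr. Qed.

Lemma sym_avgZ T s (c : R) f x :
  sym_avg T s (fun y => c * f y) x = c * sym_avg T s f x.
Proof. by rewrite /sym_avg -mulr_sumr mulrCA. Qed.

(** A shift by at most [s] keeps the window inside the one of half-width [2 * s]. The factor 2
    compares the normalizations, as [2 * s + 1 <= 2 * (s + 1)]. *)
Lemma sym_avg_shift T s (f : X -> R) (a : int) x : (forall x, 0 <= f x) ->
  (absz a <= s)%N -> sym_avg T s f (mpt_zpow T a x) <= 2 * sym_avg T (s + s)%N f x.
Proof.
move=> f0 aS.
(* [b] is the position at which the shifted window starts inside the doubled one. *)
have [b [bE bs]] : exists b : nat, a = b%:Z - s%:Z /\ (b <= s + s)%N.
  by exists (absz (a + s%:Z)); split; lia.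
pose h (j : nat) := f (mpt_zpow T (j%:Z - (s + s)%N%:Z) x).
have -> : sym_avg T s f (mpt_zpow T a x) =
    (4 * s.+1%:R)^-1 * \sum_(b <= j < b + (s + s).+1) h j.
  congr (_ * _); rewrite -{1}[b]add0n big_addn addnC addnK.
  apply: eq_bigr => k _; rewrite -mpt_zpowD /h; congr (f (mpt_zpow _ _ _)); lia.
apply: (@le_trans _ _ ((4 * s.+1%:R)^-1 * \sum_(0 <= j < (s + s + (s + s)).+1) h j)).
  rewrite ler_wpM2l ?invr_ge0 ?mulr_ge0//.
  rewrite [leRHS](@big_cat_nat _ _ _ b)//=; last by lia.
  rewrite [X in _ <= _ + X](@big_cat_nat _ _ _ (b + (s + s).+1)%N)//=; [|lia|lia].
  by rewrite addrCA lerDl addr_ge0// sumr_ge0// => j _; exact: f0.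
rewrite /sym_avg mulrA ler_wpM2r ?sumr_ge0//.
  by move=> j _; exact: f0.
rewrite !invfM mulrCA ler_wpM2l//.
rewrite ler_pdivlMr ?ltr0n// ler_pdivrMl ?ltr0n// -natrM ler_nat; lia.
Qed.

End commuting_powers.

(** * The action of exponent vectors and box averages *)

Section family_action.
Context {disp : measure_display} {X : measurableType disp} {R : realType}.
Context {mu : probability X R} {n : nat}.
Variable U : 'I_n -> invertible_mpt mu.
Hypothesis U_comm : commuting U.
Implicit Types (l : seq 'I_n) (s : 'I_n -> nat) (f g : X -> R) (a p : 'I_n -> int).

(** A common form for the products in [dependent], where the list is a filtered enumeration, and in
    [iter_family]. *)
Definition act l a : X -> X := \big[(@comp X X X)/id]_(i <- l) mpt_zpow (U i) (a i).

Lemma act_cons i l a x : act (i :: l) a x = mpt_zpow (U i) (a i) (act l a x).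
Proof. by rewrite /act big_cons. Qed.

Lemma mpt_zpow_comm i j (q : int) x :
  mpt_zpow (U i) q (U j x) = U j (mpt_zpow (U i) q x).
Proof. by rewrite (@zpow_commute _ _ _ _ (U i) (U j))// => y; exact: U_comm. Qed.

Lemma act_comm l a j x : act l a (U j x) = U j (act l a x).
Proof.
elim: l => [|i l IH]; first by rewrite /act big_nil.
by rewrite !act_cons IH mpt_zpow_comm.
Qed.

Lemma act_zpow_comm l a j (q : int) x :
  act l a (mpt_zpow (U j) q x) = mpt_zpow (U j) q (act l a x).
Proof. by apply: zpow_commute => y; exact: act_comm. Qed.

Lemma actD l a b x : act l (fun i => a i + b i) x = act l a (act l b x).
Proof.
elim: l => [|i l IH]; first by rewrite /act !big_nil.
by rewrite !act_cons IH act_zpow_comm mpt_zpowD.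
Qed.

Lemma eq_act l a b : a =1 b -> act l a = act l b.
Proof. by move=> ab; apply: eq_bigr => i _; rewrite ab. Qed.

Lemma act0 l x : act l (fun=> 0) x = x.
Proof. by elim: l => [|i l IH]; rewrite ?act_cons ?IH// /act big_nil. Qed.

(** By [actD], the exponent vectors fixing a given [x] form a group. The argument is pointwise, so
    no further null set arises. *)
Lemma act_fixed_mul l p (m : int) x : act l p x = x -> act l (fun i => m * p i) x = x.
Proof.
move=> px.
have npx : act l (fun i => - p i) x = x.
  rewrite -[in LHS]px -actD -[RHS](act0 l); congr (_ _); apply: eq_act => i.
  by rewrite addNr.
elim: m => [|m IH|m IH].
- by rewrite -[RHS](act0 l); congr (_ _); apply: eq_act => i; rewrite mul0r.
- rewrite (@eq_act _ _ (fun i => p i + m%:Z * p i)) ?actD ?IH// => i.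
  by rewrite -addn1 PoszD mulrDl mul1r addrC.
- rewrite (@eq_act _ _ (fun i => - p i + (- m%:Z) * p i)) ?actD ?IH// => i.
  by rewrite -addn1 PoszD opprD mulrDl mulN1r addrC.
Qed.

Lemma act_rem l i a x : i \in l ->
  act l a x = mpt_zpow (U i) (a i) (act (rem i l) a x).
Proof.
elim: l => //= j l IH; rewrite inE; case: (eqVneq j i) => [-> _|ji /=].
  by rewrite act_cons.
move=> il; rewrite !act_cons IH//.
by apply: zpow_commute => y; rewrite mpt_zpow_comm.
Qed.

Lemma box_avg_sum (I : Type) (r : seq I) l s (f : I -> X -> R) x :
  box_avg U l s (fun y => \sum_(k <- r) f k y) x = \sum_(k <- r) box_avg U l s (f k) x.
Proof.
elim: l f => //= i l IH f; rewrite -IH; congr (box_avg _ _ _ _ _).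
by apply/funext => y; rewrite sym_avg_sum.
Qed.

Lemma box_avgZ l s (c : R) f x :
  box_avg U l s (fun y => c * f y) x = c * box_avg U l s f x.
Proof.
elim: l f => //= i l IH f; rewrite -IH; congr (box_avg _ _ _ _ _).
by apply/funext => y; rewrite sym_avgZ.
Qed.

Lemma sym_avgC i j (N M : nat) f x :
  sym_avg (U i) N (sym_avg (U j) M f) x = sym_avg (U j) M (sym_avg (U i) N f) x.
Proof.
rewrite [LHS]sym_avgZ sym_avg_sum; congr (_ * _); apply: eq_bigr => k _.
by rewrite sym_avg_comp// => y; rewrite mpt_zpow_comm.
Qed.

Lemma box_avg_rem l s f i : i \in l ->
  box_avg U l s f = box_avg U (rem i l) s (sym_avg (U i) (s i) f).
Proof.
elim: l f => //= j l IH f; rewrite inE; case: (eqVneq j i) => [-> _//|ji /=].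
move=> il; rewrite IH//; congr (box_avg _ _ _ _).
by apply/funext => x; rewrite sym_avgC.
Qed.

(** The maps commute, so each direction absorbs its own component of the shift by [sym_avg_shift],
    at the cost of a factor 2. *)
Lemma box_avg_shift l s f a : (forall x, 0 <= f x) ->
  (forall i, i \in l -> (absz (a i) <= s i)%N) ->
  forall x, box_avg U l s (fun y => f (act l a y)) x <=
            2 ^+ size l * box_avg U l (fun i => s i + s i)%N f x.
Proof.
elim: l f => [|i l IH] f f0 al x; first by rewrite /act big_nil expr0 mul1r.
rewrite /= exprSr -mulrA.
pose g y := 2 * sym_avg (U i) (s i + s i)%N f y.
have g0 y : 0 <= g y by rewrite mulr_ge0// sym_avg_ge0.
apply: (@le_trans _ _ (box_avg U l s (fun y => g (act l a y)) x)).
  apply: le_box_avg => y; under [X in sym_avg _ _ X]eq_fun do rewrite act_cons.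
  rewrite (@sym_avg_comp _ _ _ _ (U i) _ (fun z => f (mpt_zpow (U i) (a i) z))).
    rewrite sym_avg_comp; last by move=> z; rewrite mpt_zpow_comm.
    by apply: sym_avg_shift => //; apply: al; rewrite mem_head.
  by move=> z; exact: act_comm.
rewrite -[2 * _]box_avgZ; apply: (IH g) => // j jl.
by apply: al; rewrite inE jl orbT.
Qed.

Lemma ae_comp_mp (h : X -> X) (P : X -> Prop) : measure_preserving mu h ->
  {ae mu, forall x, P x} -> {ae mu, forall x, P (h x)}.
Proof.
move=> [mh muh] [A [mA A0 PA]]; exists (h @^-1` A); split.
- by rewrite -[X in measurable X]setTI; exact: mh.
- by rewrite muh.
- by move=> x /= nP; apply: PA.
Qed.

(** Powers of [T] pull null sets back to null sets, and only countably many powers occur. *)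
Lemma ae_le_sym_avg (T : invertible_mpt mu) (N : nat) f g :
  {ae mu, forall x, f x <= g x} ->
  {ae mu, forall x, sym_avg T N f x <= sym_avg T N g x}.
Proof.
move=> fg; have H (k : nat) := ae_comp_mp (measure_preserving_zpow T (k%:Z - N%:Z)) fg.
apply: filterS (ae_foralln H) => x Hx.
by rewrite ler_wpM2l ?invr_ge0 ?mulr_ge0// ler_sum.
Qed.

Lemma ae_le_box_avg l s f g : {ae mu, forall x, f x <= g x} ->
  {ae mu, forall x, box_avg U l s f x <= box_avg U l s g x}.
Proof. by elim: l f g => //= i l IH f g fg; apply: IH; exact: ae_le_sym_avg. Qed.

End family_action.

(** * Union bounds and estimates for fixed averages *)

Section weak_type_tools.
Context {disp : measure_display} {X : measurableType disp} {R : realType}.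
Context {mu : probability X R}.

Lemma ae_le_measure_sum (I : eqType) (r : seq I) (A : set X) (B : I -> set X) :
  measurable A -> (forall i, measurable (B i)) ->
  {ae mu, forall x, A x -> exists2 i, i \in r & B i x} ->
  (mu A <= \sum_(i <- r) mu (B i))%E.
Proof.
move=> mA mB AB.
have mI C : measurable C -> measurable_fun [set: X] (fun x => (\1_C x : R)%:E).
  by move=> mC; apply/measurable_EFinP/measurable_indic.
rewrite -(mu_indicE mu mA); under eq_bigr do rewrite -(mu_indicE mu (mB _)).
rewrite -ge0_integral_sum//; last by move=> i; exact: mI.
apply: ae_ge0_le_integral => //; first exact: mI.
- by move=> x _; rewrite sume_ge0.
- by apply: emeasurable_sum => i; exact: mI.
apply: filterS AB => x AB _; rewrite sumEFin lee_fin.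
rewrite indicE; have [/set_mem/AB[i ir Bx]|_] := boolP (x \in A); last exact: sumr_ge0.
rewrite (big_rem i)//= indicE mem_set// lerDl sumr_ge0//.
Qed.

(** A sum of [M] terms is at most [M] times the largest one, and the value of [zyg] there is one of
    the summands on the right. *)
Lemma zyg_sum m (M : nat) (y : nat -> R) : (forall k, 0 <= y k) ->
  (zyg m (\sum_(0 <= k < M) y k) <= \sum_(0 <= k < M) zyg m (M%:R * y k))%E.
Proof.
move=> y0; case: M => [|M]; first by rewrite !big_geq// /zyg dyadic_sum_eq0.
rewrite !big_mkord.
pose k0 := [arg max_(k > ord0) y (nat_of_ord k)]%O : 'I_M.+1.
have yk0 (k : 'I_M.+1) : y k <= y k0 by rewrite /k0; case: arg_maxP => // i _; exact.
rewrite [leRHS](bigD1 k0)//= -[leLHS]adde0 leeD ?sume_ge0// => [|k _];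
  last exact: zyg_ge0.
apply: le_zyg => //; apply: (@le_trans _ _ (\sum_(k < M.+1) y k0)).
  by apply: ler_sum => k _; exact: yk0.
by rewrite sumr_const card_ord mulr_natl.
Qed.

(** The normalization is at most 1, so the average is bounded by its plain sum, to which [zyg_sum]
    and invariance apply. The crude dependence on [N] is harmless: [N] will be an exponent [|p i|]
    of a fixed relation. *)
Lemma integral_zyg_sym_avg (T : invertible_mpt mu) m N (c : R) (f : X -> R) :
  0 <= c -> measurable_fun [set: X] f -> (forall x, 0 <= f x) ->
  (\int[mu]_x zyg m (c * sym_avg T N f x) <=
   ((N + N).+1%:R)%:E * \int[mu]_x zyg m ((N + N).+1%:R * c * f x))%E.
Proof.
move=> c0 mf f0; set M := (N + N).+1.
have mz (k : int) : measurable_fun [set: X]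
    (fun x => zyg m (M%:R * (c * f (mpt_zpow T k x)))).
  apply: measurable_zyg; apply: measurable_funM => //; apply: measurable_funM => //.
  exact: measurable_zpow_comp.
pose z (k : nat) : int := k%:Z - N%:Z.
apply: (@le_trans _ _ (\int[mu]_x
    \sum_(0 <= k < M) zyg m (M%:R * (c * f (mpt_zpow T (z k) x))))%E).
  apply: ge0_le_integral => //.
  - by move=> x _; exact: zyg_ge0.
  - by apply: measurable_zyg; apply: measurable_funM => //; exact: measurable_sym_avg.
  - by apply: emeasurable_sum => k.
  move=> x _; apply: le_trans (zyg_sum _ _ _); last by move=> k; rewrite mulr_ge0.
  apply: le_zyg => //; rewrite -mulr_sumr ler_wpM2l// ler_piMl ?sumr_ge0//.
  by rewrite invf_le1 ?mulr_gt0// -natrM ler1n.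
rewrite ge0_integral_sum//; last by move=> k x _; exact: zyg_ge0.
rewrite (eq_bigr (fun=> 1%:E * \int[mu]_x zyg m (M%:R * c * f x))%E); last first.
  move=> k _; rewrite mul1e.
  rewrite -(ge0_integral_comp_mp (measure_preserving_zpow T (z k))
             (f := fun x => zyg m (M%:R * c * f x))).
  - by apply: eq_integral => x _; rewrite mulrA.
  - by apply: measurable_zyg; apply: measurable_funM.
  - by move=> x; exact: zyg_ge0.
by rewrite -ge0_sume_distrl// sumEFin big_const_nat iter_addr addr0 subn0.
Qed.

(** This trades a bounded power of [T], which will vary with the term of a sum, for one function
    independent of [r]. *)
Lemma le_sym_avg_term (T : invertible_mpt mu) (P : nat) (r : int) (f : X -> R) x :
  (forall x, 0 <= f x) -> (absz r <= P)%N ->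
  f (mpt_zpow T r x) <= 4 * P.+1%:R * sym_avg T P f x.
Proof.
move=> f0 rP; rewrite mulVKf ?mulf_neq0 ?pnatr_eq0//.
have jP : absz (r + P%:Z) \in index_iota 0 (P + P).+1 by rewrite mem_index_iota; lia.
rewrite (big_rem _ jP)/= (_ : (absz (r + P%:Z))%:Z - P%:Z = r); last by lia.
by rewrite lerDl sumr_ge0//.
Qed.

End weak_type_tools.

(** * Elimination of directions along a relation *)

Section reduction.
Context {disp : measure_display} {X : measurableType disp} {R : realType}.
Context {mu : probability X R} {n : nat}.
Variable U : 'I_n -> invertible_mpt mu.
Hypothesis U_comm : commuting U.
Implicit Types (l : seq 'I_n) (s : 'I_n -> nat) (f g : X -> R) (p : 'I_n -> int).

(** The power of 2 pays for the shifts in [box_avg_shift], the other factor for [le_sym_avg_term].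
    Nothing here depends on the box [s], so finitely many functions serve all boxes. *)
Definition reduced l p f i : X -> R :=
  fun x => 2 ^+ size l * (4 * (absz (p i)).+1%:R) * sym_avg (U i) (absz (p i)) f x.

(* At a fixed point [x] of the relation, [U i ^ k x] is [U i ^ (k - m * p i)]
   applied to the product of the [U j ^ (- m * p j)], [j != i]; choosing [m] as the
   truncated quotient of [k] by [p i], the minimality of [s i / |p i|] gives
   [|m * p j| <= s j], so that direction [i] can be absorbed in the others. *)
Lemma box_avg_reduce l s p f i : i \in l -> p i != 0 ->
  (forall j, j \in l -> s i * absz (p j) <= s j * absz (p i))%N ->
  {ae mu, forall x, act U l p x = x} -> (forall x, 0 <= f x) ->
  {ae mu, forall x, box_avg U l s f x <=
     box_avg U (rem i l) (fun j => s j + s j)%N (reduced l p f i) x}.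
Proof.
move=> il pi0 smin pfix f0; set P := absz (p i); set l' := rem i l.
have [m mP] : {m : int -> int & forall k : int,
    (absz (k - m k * p i)%R <= P)%N /\ (absz (m k) * P <= absz k)%N}.
  by apply: (@choice _ _ (fun k q : int =>
    (absz (k - q * p i)%R <= P)%N /\ (absz q * P <= absz k)%N)) => k; exact: int_trunc_div.
pose G y := 4 * P.+1%:R * sym_avg (U i) P f y.
have G0 y : 0 <= G y by rewrite mulr_ge0 ?sym_avg_ge0// mulr_ge0.
pose z (k : nat) : int := k%:Z - (s i)%:Z.
pose a (k : nat) (j : 'I_n) := - m (z k) * p j.
pose c : R := (4 * (s i).+1%:R)^-1.
have c0 : 0 <= c by rewrite invr_ge0 mulr_ge0.
have step1 : {ae mu, forall x, sym_avg (U i) (s i) f x <=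
    c * \sum_(0 <= k < (s i + s i).+1) G (act U l' (a k) x)}.
  apply: filterS pfix => x px; rewrite ler_wpM2l// ler_sum// => k _.
  rewrite -{1}(act_fixed_mul U_comm (- m (z k)) px) (act_rem U_comm _ _ il).
  rewrite -mpt_zpowD; apply: le_sym_avg_term => //.
  by rewrite mulNr; have [] := mP (z k).
rewrite (box_avg_rem U_comm _ _ il).
apply: filterS (ae_le_box_avg U l' s step1) => x /le_trans; apply.
rewrite box_avgZ box_avg_sum.
have step2 k : (k < (s i + s i).+1)%N ->
    box_avg U l' s (fun y => G (act U l' (a k) y)) x <=
    2 ^+ size l' * box_avg U l' (fun j => s j + s j)%N G x.
  move=> ks; apply: box_avg_shift => // j /mem_rem jl.
  have [_ mk] := mP (z k).
  have zk : (absz (z k) <= s i)%N by rewrite /z; lia.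
  have P0 : (0 < P)%N by rewrite absz_gt0.
  (* After multiplication by [P], the shift in direction [j] is at most
     [|z k| * |p j| <= s i * |p j|], which minimality bounds by [s j * P]. *)
  rewrite -(leq_pmul2r P0) /a abszM abszN mulnAC.
  by apply: leq_trans (smin _ jl); rewrite leq_mul2r (leq_trans mk zk) orbT.
set B := box_avg U l' _ G x in step2 *.
have B0 : 0 <= B by exact: box_avg_ge0.
apply: (@le_trans _ _ (2 ^+ size l' * B)).
  (* There are [2 * s i + 1] terms against the normalization [4 * (s i + 1)], so their average is at
     most the common bound. *)
  apply: (@le_trans _ _ (c * \sum_(0 <= k < (s i + s i).+1) (2 ^+ size l' * B))).
    by rewrite ler_wpM2l// ler_sum_nat// => k /andP[_]; exact: step2.
  rewrite big_const_nat iter_addr addr0 subn0 -[X in c * X]mulr_natl mulrA.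
  rewrite ler_piMl ?mulr_ge0 ?exprn_ge0// mulrC ler_pdivrMr ?mulr_gt0//.
  by rewrite mul1r -natrM ler_nat; lia.

rewrite [X in _ <= X](_ : _ = 2 ^+ size l * B).
  by rewrite ler_wpM2r// ler_weXn2l ?ler1n// size_rem// leq_pred.
rewrite /B -box_avgZ; congr (box_avg _ _ _ _ _); apply/funext => y.
by rewrite /G mulrA.
Qed.

Lemma exists_min_ratio l s p : (exists2 i, i \in l & p i != 0) ->
  exists i, [/\ i \in l, p i != 0 &
    forall j, j \in l -> (s i * absz (p j) <= s j * absz (p i))%N].
Proof.
move=> [i0 il pi0].
pose Q (i : 'I_n) := (i \in l) && (p i != 0).
have Q0 : Q i0 by rewrite /Q il.
pose F (i : 'I_n) : rat := (s i)%:R / (absz (p i))%:R.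
case: (arg_minP F Q0) => i /andP[iil pi] imin.
exists i; split=> // j jl.
have [->|pj] := eqVneq (p j) 0; first by rewrite muln0.
have := imin j; rewrite /Q jl pj => /(_ isT).
rewrite /F ler_pdivrMr ?ltr0n ?absz_gt0// mulrAC ler_pdivlMr ?ltr0n ?absz_gt0//.
by rewrite -!natrM ler_nat.
Qed.

(** The minimizing direction depends on the box, hence the disjunction over [l]. Boxes are
    enumerated by [pickle] so that the exceptional null sets are countably many. *)
Lemma ae_exceed_reduce l p f : {ae mu, forall x, act U l p x = x} ->
  (exists2 i, i \in l & p i != 0) -> (forall x, 0 <= f x) ->
  {ae mu, forall x, exceed U l f x ->
    exists2 i, i \in l & exceed U (rem i l) (reduced l p f i) x}.
Proof.
move=> pfix pl f0.
have H (k : nat) : {ae mu, forall x, if @unpickle {ffun 'I_n -> nat} k is Some s then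
    1 < box_avg U l s f x ->
    exists2 i, i \in l & exceed U (rem i l) (reduced l p f i) x else True}.
  case: unpickle => [s|]; last exact: aeW.
  have [i [il pi0 imin]] := exists_min_ratio s pl.
  apply: filterS (box_avg_reduce il pi0 imin pfix f0) => x Hx sx.
  by exists i => //; eexists; exact: lt_le_trans sx Hx.
apply: filterS (ae_foralln H) => x Hx [s sx].
have := Hx (pickle (finfun s)); rewrite pickleK; apply.
by rewrite (eq_box_avg _ _ _ (ffunE s)).
Qed.

(** The dilation [c] stays inside [zyg], which is not homogeneous. The order [d] is kept apart from
    the length of [l], which may be larger. *)
Definition weak_bound d l := exists c K : R, [/\ 0 <= c, 0 <= K &
  forall f, measurable_fun [set: X] f -> (forall x, 0 <= f x) ->
    (mu (exceed U l f) <= K%:E * \int[mu]_x zyg d (c * f x))%E].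

(** Almost everywhere, the exceedance set is covered by those of the reduced functions, one per
    direction. The hypothesis bounds each of these, and [integral_zyg_sym_avg] removes the average
    inside [reduced]. *)
Lemma weak_bound_reduce d l p : {ae mu, forall x, act U l p x = x} ->
  (exists2 i, i \in l & p i != 0) ->
  (forall i, i \in l -> weak_bound d (rem i l)) -> weak_bound d l.
Proof.
move=> pfix pl IH.
have mred f i : measurable_fun [set: X] f -> measurable_fun [set: X] (reduced l p f i).
  by move=> mf; apply: measurable_funM => //; exact: measurable_sym_avg.
have red0 f i : (forall x, 0 <= f x) -> forall x, 0 <= reduced l p f i x.
  by move=> f0 x; rewrite mulr_ge0 ?sym_avg_ge0// mulr_ge0 ?exprn_ge0// mulr_ge0.
(* Induction on a sublist [r] merges the constants: dilations by maximum, as [zyg] is monotone, and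
   factors by addition. *)
suff /(_ l (fun _ => id)) [c [K [c0 K0 H]]] : forall r, {subset r <= l} ->
  exists c K : R, [/\ 0 <= c, 0 <= K &
  forall f, measurable_fun [set: X] f -> (forall x, 0 <= f x) ->
    (\sum_(i <- r) mu (exceed U (rem i l) (reduced l p f i)) <=
     K%:E * \int[mu]_x zyg d (c * f x))%E].
  exists c, K; split=> // f mf f0; apply: le_trans (H f mf f0).
  apply: ae_le_measure_sum.
  - exact: measurable_exceed.
  - by move=> i; apply: measurable_exceed; exact: mred.
  - exact: ae_exceed_reduce.
elim=> [|i r IHr] rl.
  exists 0, 0; split=> // f mf f0; by rewrite big_nil mul0e.
have [|c [K [c0 K0 H]]] := IHr; first by move=> j jr; apply: rl; rewrite inE jr orbT.
have /rl/IH[c' [K' [c'0 K'0 H']]] : i \in i :: r by exact: mem_head.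
pose P := absz (p i).
pose C : R := 2 ^+ size l * (4 * P.+1%:R).
have C0 : 0 <= C by rewrite mulr_ge0 ?exprn_ge0// mulr_ge0.
pose D : R := (P + P).+1%:R * (c' * C).
have D0 : 0 <= D by rewrite mulr_ge0// mulr_ge0.
exists (Num.max D c), (K' * (P + P).+1%:R + K); split.
- by rewrite le_max D0.
- by rewrite addr_ge0// mulr_ge0.
move=> f mf f0.
have mz e : measurable_fun [set: X] (fun x => zyg d (e * f x)).
  by apply: measurable_zyg; apply: measurable_funM.
have mono e : e <= Num.max D c ->
    (\int[mu]_x zyg d (e * f x) <= \int[mu]_x zyg d (Num.max D c * f x))%E.
  move=> eD; apply: ge0_le_integral => //.
  - by move=> x _; exact: zyg_ge0.
  - by move=> x _; apply: le_zyg => //; rewrite ler_wpM2r.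
rewrite big_cons EFinD ge0_muleDl ?lee_fin ?mulr_ge0//; apply: leeD; last first.
  apply: le_trans (H f mf f0) _; rewrite lee_wpmul2l ?lee_fin//.
  by apply: mono; rewrite le_max lexx orbT.
apply: le_trans (H' _ (mred f i mf) (red0 f i f0)) _.
rewrite EFinM -muleA lee_wpmul2l ?lee_fin//.
under eq_integral do rewrite /reduced mulrA.
have cC0 : 0 <= c' * C by rewrite mulr_ge0.
apply: le_trans (integral_zyg_sym_avg (U i) d P cC0 mf f0) _.
by rewrite lee_wpmul2l ?lee_fin//; apply: mono; rewrite le_max lexx.
Qed.

(* The order of the enumeration is that of the products in [dependent], as
   [big_enum] is only available for commutative operators. *)
Definition set_seq (J : {set 'I_n}) : seq 'I_n := [seq i <- index_enum 'I_n | i \in J].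

Lemma mem_set_seq (J : {set 'I_n}) i : (i \in set_seq J) = (i \in J).
Proof. by rewrite mem_filter mem_index_enum andbT. Qed.

Lemma size_set_seq (J : {set 'I_n}) : size (set_seq J) = #|J|.
Proof. by rewrite -sum1_size big_filter sum1_card. Qed.

Lemma rem_set_seq (J : {set 'I_n}) i : rem i (set_seq J) = set_seq (J :\ i).
Proof.
rewrite rem_filter ?filter_uniq ?index_enum_uniq// -filter_predI.
by apply: eq_filter => j; rewrite !inE.
Qed.

(** Induction on the cardinality of [J]. An independent [J] has at most [d] elements and Zygmund's
    inequality applies; a dependent one is reduced to the sets [J :\ j]. *)
Lemma weak_bound_rank d (J : {set 'I_n}) : (mpt_rank U <= d)%N ->
  weak_bound d (set_seq J).
Proof.
move=> rank_d; have [m] := ubnP #|J|; elim: m J => // m IH J; rewrite ltnS => Jm.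
have [indep|/contrapT [p [[i iJ pi0] pfix]]] := pselect (independent U J).
  have Jd : (size (set_seq J) <= d)%N.
    rewrite size_set_seq; apply: leq_trans rank_d.
    by rewrite /mpt_rank leq_bigmax_cond//; apply/asboolP.
  exists 1, (4 ^+ size (set_seq J)); split=> //.
  move=> f mf f0; apply: le_trans (zygmund_exceed U _ mf f0) _.
  rewrite lee_wpmul2l ?lee_fin ?exprn_ge0//; apply: ge0_le_integral => //.
  - by move=> x _; exact: zyg_ge0.
  - exact: measurable_zyg.
  - by apply: measurable_zyg; apply: measurable_funM.
  by move=> x _; rewrite mul1r; exact: le_zyg.
apply: (@weak_bound_reduce d _ p); first by rewrite /act big_filter.
  by exists i; rewrite ?mem_set_seq.
move=> j; rewrite mem_set_seq => jJ; rewrite rem_set_seq; apply: IH.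
by rewrite (cardsD1 j) jJ in Jm.
Qed.

End reduction.

(** * Comparison of [zyg] with [Log] *)

Section Log_comparison.
Context {R : realType}.

Lemma Log_ge0 m (t : R) : 0 <= t -> 0 <= Log m t.
Proof.
by case: m => [|m] t0 //=; rewrite mulr_ge0// addr_ge0// le_max lexx.
Qed.

Lemma measurable_Log m : measurable_fun [set: R] (Log m : R -> R).
Proof.
case: m => [|m]; first exact: measurable_id.
apply: measurable_funM => //; apply: measurable_funD => //.
apply: measurable_maxr => //; apply: measurable_funX; exact: measurable_ln.
Qed.

Lemma zyg_le_Log k (C : R) : 0 <= C -> exists2 C', 0 <= C' &
  forall t, 0 <= t -> (zyg k.+1 (C * t) <= (C' * Log k t)%:E)%E.
Proof.
move=> C0; have ln2 : 0 < ln 2 :> R by rewrite ln_gt0// ltr1n.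
(* Chosen so that [2 ^+ N < C * t] implies [N.+1 <= B * max 1 (ln t)]: take logarithms and bound
   [ln C + ln t] by [(|ln C| + 1) * max 1 (ln t)]. *)
pose B : R := 1 + (`|ln C| + 1) / ln 2.
have B1 : 1 <= B by rewrite lerDl divr_ge0 ?addr_ge0// ltW.
have B0 : 0 <= B by exact: le_trans B1.
exists (2 * C * B ^+ k) => [|t t0]; first by rewrite mulr_ge0 ?exprn_ge0// mulr_ge0.
have [Ct1|Ct1] := leP (C * t) 1.
  by rewrite /zyg dyadic_sum_eq0// lee_fin mulr_ge0 ?Log_ge0// mulr_ge0 ?exprn_ge0// mulr_ge0.
have [N [CtN lvl]] := dyadic_level Ct1.
have Ct0 : 0 < C * t by exact: lt_trans Ct1.
have Cpos : 0 < C.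
  by rewrite lt_neqAle C0 andbT; apply: contraTneq Ct0 => <-; rewrite mul0r ltxx.
have tpos : 0 < t by rewrite -(pmulr_rgt0 _ Cpos).
have NCt : 2 ^+ N < C * t by rewrite lvl.
rewrite /zyg (dyadic_sumE _ lvl); last by move=> i; exact: zyg_weight_ge0.
rewrite lee_fin.
have logN : N.+1%:R <= B * Num.max 1 (ln t).
  have m1 : 1 <= Num.max 1 (ln t) by rewrite le_max lexx.
  have mt : ln t <= Num.max 1 (ln t) by rewrite le_max lexx orbT.
  have : ln (2 ^+ N) <= ln (C * t) by rewrite ler_ln ?posrE ?exprn_gt0// ltW.
  rewrite lnXn// lnM ?posrE// -[leLHS]mulr_natl => H.
  rewrite /B mulrDl mul1r -natr1 addrC lerD//.
  rewrite mulrAC ler_pdivlMr// mulrDl mul1r.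
  apply: le_trans H _; apply: lerD => //.
  by apply: le_trans (ler_norm _) _; rewrite ler_peMr.
have powN : N.+1%:R ^+ k * t <= B ^+ k * Log k t.
  case: k => [|k]; first by rewrite !expr0 !mul1r.
  rewrite [Log _ _]/= [t * _]mulrC mulrA ler_wpM2r//.
  apply: (@le_trans _ _ ((B * Num.max 1 (ln t)) ^+ k.+1)).
    by rewrite lerXn2r// nnegrE ?mulr_ge0// le_max ler01.
  rewrite exprMn ler_wpM2l ?exprn_ge0//.
  rewrite maxEle; case: ifP => [t1|_]; last by rewrite expr1n lerDl le_max lexx.
  by rewrite ler_wpDl// le_max lexx orbT.
apply: (@le_trans _ _ (N.+1%:R ^+ k * (2 * (C * t)))).
  apply: (@le_trans _ _ (N.+1%:R ^+ k * 2 ^+ N.+1)); last first.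
    by rewrite ler_wpM2l ?exprn_ge0// exprS ler_wpM2l// ltW.
  rewrite /= (@le_trans _ _ (\sum_(0 <= i < N.+1) 2 ^+ i * N.+1%:R ^+ k))//.
    apply: ler_sum_nat => i /andP[_ iN]; rewrite ler_wpM2l ?exprn_ge0//.
    by rewrite lerXn2r// ?nnegrE// ler_nat.
  rewrite -mulr_suml mulrC ler_wpM2l ?exprn_ge0//.
  (* The geometric sum of [2 ^+ i] over [i < M] is at most [2 ^+ M]. *)
  elim: N.+1 => [|M IH]; first by rewrite big_geq// exprn_ge0.
  rewrite big_nat_recr//= exprS (natrD _ 1 1) mulrDl mul1r lerD2r.
  exact: IH.
rewrite [leLHS](_ : _ = 2 * C * (N.+1%:R ^+ k * t)); last by ring.
by rewrite -[leRHS]mulrA ler_wpM2l// mulr_ge0.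
Qed.

End Log_comparison.

(** * From one-sided rectangles to symmetric boxes *)

Section rectangles.
Context {disp : measure_display} {X : measurableType disp} {R : realType}.
Context {mu : probability X R} {n : nat}.
Variable U : 'I_n -> invertible_mpt mu.
Hypothesis U_comm : commuting U.
Implicit Types (l : seq 'I_n) (f g : X -> R).

(** The exponents [0..s-1] form the upper half of the window of half-width [s.-1], whose
    normalization is exactly [4 * s]. *)
Lemma one_sided_sum_le (T : invertible_mpt mu) (s : nat) g x : (0 < s)%N ->
  (forall x, 0 <= g x) ->
  \sum_(j < s) g (iter j T x) <= 4 * s%:R * sym_avg T s.-1 g x.
Proof.
case: s => // s _ g0; rewrite /= mulVKf ?mulf_neq0 ?pnatr_eq0//.
rewrite [leRHS](@big_cat_nat _ _ _ s)//=; last by rewrite -addnS leq_addr.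
rewrite ler_wpDl ?sumr_ge0// -{1}[s in leRHS]add0n big_addn -addSn addnK big_mkord.
apply: ler_sum => j _; rewrite le_eqVlt; apply/orP; left; apply/eqP.
by congr g; rewrite (_ : _ - _ = (j : nat)%:Z)//; lia.
Qed.

Lemma box_avg_sym_avgC l s i (N : nat) f x :
  box_avg U l s (sym_avg (U i) N f) x = sym_avg (U i) N (box_avg U l s f) x.
Proof.
elim: l f => //= j l IH f; rewrite -IH; congr (box_avg _ _ _ _ _).
by apply/funext => y; exact: sym_avgC.
Qed.

Lemma eq_in_act l (a b : 'I_n -> int) : {in l, a =1 b} -> act U l a = act U l b.
Proof. by move=> ab; apply: eq_big_seq => i il; rewrite ab. Qed.

Lemma iter_familyE (k : 'I_n -> nat) :
  iter_family U k = act U (index_enum 'I_n) (fun i => (k i)%:Z).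
Proof. by []. Qed.

Lemma fiber_sum_le (s : 'I_n -> nat) l (t : {dffun forall i : 'I_n, 'I_(s i)}) g x :
  (forall i, (0 < s i)%N) -> uniq l -> (forall x, 0 <= g x) ->
  \sum_(k : {dffun forall i : 'I_n, 'I_(s i)} | [forall i, (i \notin l) ==> (k i == t i)])
     g (iter_family U (fun i => k i : nat) x) <=
  (\prod_(i <- l) (4 * (s i)%:R)) *
  box_avg U l (fun i => (s i).-1) g
    (act U (index_enum 'I_n) (fun i => (if i \in l then 0%N else t i : nat)%:Z) x).
Proof.
move=> s0; elim: l t => [|i l IH] t.
  move=> _ g0; rewrite big_nil mul1r (big_pred1 t)//= => k.
  apply/forallP/eqP => [kt|-> //]; apply/ffunP => i; apply/eqP.
  exact: (kt i).
rewrite [uniq _]/= => /andP[il ul] g0; rewrite big_cons.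
rewrite (partition_big (fun k : {dffun forall i : 'I_n, 'I_(s i)} => k i) xpredT)//=.
set y := act _ _ _ _; set C := \prod_(_ <- _) _.
have C0 : 0 <= C by apply: prodr_ge0 => j _; rewrite mulr_ge0.
have key (j : 'I_(s i)) :
    \sum_(k : {dffun forall i : 'I_n, 'I_(s i)} |
       [forall i', (i' \notin i :: l) ==> (k i' == t i')] && (k i == j))
       g (iter_family U (fun i => k i : nat) x) <=
    C * box_avg U l (fun i => (s i).-1) g (iter j (U i) y).
  (* Fixing coordinate [i] at [j] amounts to freezing it, so the fiber is again of the form covered
     by the induction hypothesis. *)
  pose t' : {dffun forall i : 'I_n, 'I_(s i)} :=
    [ffun i' => @dfwith _ (fun i => 'I_(s i)) t i j i'].
  have t'i : t' i = j by rewrite ffunE dfwithin.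
  have t'o i' : i' != i -> t' i' = t i' by move=> ii; rewrite ffunE dfwithout// eq_sym.
  rewrite (eq_bigl (fun k : {dffun forall i : 'I_n, 'I_(s i)} =>
      [forall i', (i' \notin l) ==> (k i' == t' i')])); last first.
    move=> k; apply/andP/forallP => [[/forallP kt /eqP ki] i'|kt].
      have [->|ii] := eqVneq i' i; first by rewrite t'i ki eqxx implybT.
      by have := kt i'; rewrite inE (negPf ii) t'o.
    split; last by have := implyP (kt i) il; rewrite t'i.
    apply/forallP => i'; rewrite inE negb_or; apply/implyP => /andP[ii i'l].
    by rewrite -t'o//; exact: (implyP (kt i') i'l).
  apply: le_trans (IH t' ul g0) _; rewrite ler_wpM2l//.
  rewrite le_eqVlt; apply/orP; left; apply/eqP; congr (box_avg _ _ _ _ _).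
  rewrite /y [LHS](act_rem U_comm _ _ (mem_index_enum i)).
  rewrite [act U _ _ x in RHS](act_rem U_comm _ _ (mem_index_enum i)).
  rewrite (negPf il) t'i mem_head /=; congr (iter _ _ _).
  congr (_ x); apply: eq_in_act => i'.
  rewrite mem_rem_uniq ?index_enum_uniq// inE => /andP[ii _].
  by rewrite inE (negPf ii) /= t'o.
apply: le_trans (ler_sum _ (fun j _ => key j)) _.
(* The average in direction [i] is moved outermost, where it controls the remaining one-sided sum
   over [j]. *)
rewrite -mulr_sumr [_ * C]mulrC -mulrA ler_wpM2l// box_avg_sym_avgC.
by apply: one_sided_sum_le => // z; exact: box_avg_ge0.
Qed.

Lemma rect_average_le_box_avg f (s : 'I_n -> nat) x : (forall i, (0 < s i)%N) ->
  rect_average U f s x <=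
  4 ^+ n * box_avg U (index_enum 'I_n) (fun i => (s i).-1) (fun y => `|f y|) x.
Proof.
(* Any [t] will do, since no coordinate is frozen; positivity of the sides provides one. *)
move=> s0; pose t : {dffun forall i : 'I_n, 'I_(s i)} := [ffun i => Ordinal (s0 i)].
have := @fiber_sum_le s (index_enum 'I_n) t (fun y => `|f y|) x s0
  (index_enum_uniq _) (fun y => normr_ge0 _).
rewrite (eq_bigl (fun _ : {dffun forall i : 'I_n, 'I_(s i)} => true)); last first.
  by move=> k /=; apply/forallP => i; rewrite mem_index_enum.
rewrite (_ : act U _ _ x = x); last first.
  by rewrite -[RHS](act0 U (index_enum 'I_n)); congr (_ x); apply: eq_act => i;
    rewrite mem_index_enum.
rewrite big_split/= prodr_const card_ord => H.
rewrite /rect_average ler_pdivrMl; last by apply: prodr_gt0 => i _; rewrite ltr0n.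
by rewrite mulrA [_ * 4 ^+ n]mulrC.
Qed.

Lemma measurable_rect_average f s : measurable_fun [set: X] f ->
  measurable_fun [set: X] (rect_average U f s).
Proof.
move=> mf; apply: measurable_funM => //; apply: measurable_sum => k.
apply: measurableT_comp => //; apply: measurableT_comp => //.
rewrite iter_familyE /act; elim: (index_enum _) => [|i r IH].
  by rewrite big_nil; exact: measurable_id.
rewrite big_cons; apply: measurableT_comp => //.
by have [] := measure_preserving_zpow (U i) (k i : nat)%:Z.
Qed.

Lemma measurable_strong_maximal_gt f (lambda : R) : measurable_fun [set: X] f ->
  measurable [set x | (lambda%:E < strong_maximal U f x)%E].
Proof.
move=> mf.
rewrite (_ : [set x | _] = \bigcup_(s : {ffun 'I_n -> nat})
    [set x | (forall i, (0 < s i)%N) /\ lambda < rect_average U f s x]).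
  apply: countable_bigcupT_measurable => // s.
  have [s0|s0] := pselect (forall i, (0 < s i)%N).
    rewrite (_ : [set x | _] = [set x | lambda < rect_average U f s x]).
      exact/measurable_gtr/measurable_rect_average.
    by apply/seteqP; split => x /= => [[]|].
  rewrite (_ : [set x | _] = set0); first exact: measurable0.
  by apply/seteqP; split => x //= [].
apply/seteqP; split => [x /= /ereal_sup_gt[_ [s s0 <-]]|x [s _ [s0 sx]]] /=.
  rewrite lte_fin => sx; exists (finfun s) => //=.
  have -> : finfun s = s :> ('I_n -> nat) by apply/funext => i; rewrite ffunE.
  by split.
apply: (@lt_le_trans _ _ (rect_average U f s x)%:E); first by rewrite lte_fin.
by apply: ereal_sup_ubound; exists (s : 'I_n -> nat).
Qed.

End rectangles.

(** * The weak-type inequality for the strong maximal function *)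

Theorem theorem1p1 (R : realType) (disp : measure_display)
    (X : measurableType disp) (mu : probability X R)
    (n d : nat) (U : 'I_n -> invertible_mpt mu)
    (U_comm : commuting U) (U_rank : mpt_rank U = d) (d_ge1 : (1 <= d)%N) :
  exists C : R,
    forall (f : X -> R) (lambda : R),
      LlogL mu d.-1 f -> 0 < lambda ->
      (mu [set x | lambda%:E < strong_maximal U f x] <=
       C%:E * \int[mu]_x (Log d.-1 (`|f x| / lambda))%:E)%E.
Proof.
have [c [K [c0 K0 bound]]] : weak_bound U d (index_enum 'I_n).
  have <- : set_seq [set: 'I_n]%SET = index_enum 'I_n.
    by rewrite /set_seq (eq_filter (a2 := xpredT)) ?filter_predT// => i;
      rewrite finset.in_setT.
  by apply: weak_bound_rank; rewrite // U_rank.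
have cn0 : 0 <= c * 4 ^+ n by rewrite mulr_ge0// exprn_ge0.
have [C' C'0 HC'] := zyg_le_Log d.-1 cn0; rewrite prednK// in HC'.
exists (K * C') => f lambda [mf _] lam0.
(* This scaling reduces level [lambda] to level 1 and absorbs the [4 ^+ n] lost in passing from
   rectangles to symmetric boxes. *)
pose g x := 4 ^+ n / lambda * `|f x|.
have mabs : measurable_fun [set: X] (fun x => `|f x|) by exact: measurableT_comp.
have mg : measurable_fun [set: X] g by exact: measurable_funM.
have g0 x : 0 <= g x by rewrite mulr_ge0// divr_ge0 ?exprn_ge0// ltW.
have t0 x : 0 <= `|f x| / lambda by rewrite divr_ge0// ltW.
have mLog : measurable_fun [set: X] (fun x => (Log d.-1 (`|f x| / lambda))%:E).
  apply/measurable_EFinP; apply: measurableT_comp; first exact: measurable_Log.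
  exact: measurable_funM.
apply: (@le_trans _ _ (mu (exceed U (index_enum 'I_n) g))).
  apply: le_measure; rewrite ?inE.
  - exact: measurable_strong_maximal_gt.
  - exact: measurable_exceed.
  move=> x /= /ereal_sup_gt[_ [s s0 <-]]; rewrite lte_fin => sx.
  exists (fun i => (s i).-1); rewrite box_avgZ mulrAC ltr_pdivlMr// mul1r.
  exact: lt_le_trans sx (rect_average_le_box_avg U_comm f x s0).
apply: le_trans (bound g mg g0) _.
rewrite EFinM -muleA lee_wpmul2l ?lee_fin// -ge0_integralZl_EFin//; last first.
  by move=> x _; rewrite lee_fin Log_ge0.
apply: ge0_le_integral => //.
- by move=> x _; exact: zyg_ge0.
- by apply: measurable_zyg; exact: measurable_funM.
- exact: measurable_funeM.
move=> x _; rewrite -EFinM (_ : c * g x = c * 4 ^+ n * (`|f x| / lambda)); last first.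
  by rewrite /g; ring.
exact: HC'.
Qed.
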